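(* Let $n\geq 2$, let $t$ be an indeterminate, and let $f(t)\in\mathbb{Z}[t^{\pm1}]$ be invertible. Then the mapping $\eta_2:T_n\rightarrow\mathrm{GL}_n(\mathbb{Z}[t^{\pm1}])$ given on the generators of the twin group $T_n$, for $1\leq i\leq n-1$, by $$\eta_2(s_i)=\left(\begin{array}{c|c|c} I_{i-1} & 0 & 0\\ \hline 0 & \begin{matrix}0 & f(t)\\ f(t)^{-1} & 0\end{matrix} & 0\\ \hline 0&0&I_{n-i-1}\end{array}\right)$$ defines a representation (group homomorphism) of $T_n$.
   Context: For $n\geq 2$, the twin group $T_n$ is the group with generators $s_1,\ldots,s_{n-1}$ and defining relations $s_i^2=1$ for $1\leq i\leq n-1$, and $s_is_j=s_js_i$ for $|i-j|\geq 2$. $I_r$ is the $r\times r$ identity matrix. *)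

(* Defs.v *)
From HB Require Import structures.
From mathcomp Require Import all_boot all_order all_algebra.
From mathcomp Require Import fraction.
From mathcomp Require Import boolp.

Set Implicit Arguments.
Unset Strict Implicit.
Unset Printing Implicit Defensive.

Import GRing.Theory.

(* Laurent polynomials: the subring R[X, X^-1] of the field of fractions of
   R[X], i.e. the fractions of the form p / X^k. *)
Section LaurentDef.
Local Open Scope ring_scope.
Variable R : idomainType.

Definition is_laurent : {pred {fraction {poly R}}} :=
  fun x => `[< exists (p : {poly R}) (k : nat),
    x = FracField.tofrac p / FracField.tofrac 'X^k >].

Fact is_laurent_subring : subring_closed is_laurent.
Proof.
have X0 k : FracField.tofrac ('X^k : {poly R}) != 0.
  by rewrite tofrac_eq0 -size_poly_eq0 size_polyXn.
split.
- by apply/asboolP; exists 1, 0%N; rewrite expr0 tofrac1 divr1.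
- move=> _ _ /asboolP[p [k ->]] /asboolP[q [l ->]]; apply/asboolP.
  exists (p * 'X^l - q * 'X^k), (k + l)%N.
  by rewrite exprD tofracB !tofracM -mulNr addf_div // mulNr.
- move=> _ _ /asboolP[p [k ->]] /asboolP[q [l ->]]; apply/asboolP.
  exists (p * q), (k + l)%N.
  by rewrite exprD !tofracM mulf_div.
Qed.

HB.instance Definition _ :=
  GRing.isSubringClosed.Build {fraction {poly R}} is_laurent is_laurent_subring.

Record laurent : predArgType := Laurent {
  laurent_frac :> {fraction {poly R}};
  _ : laurent_frac \in is_laurent
}.

HB.instance Definition _ := [isSub for laurent_frac].
HB.instance Definition _ := [Choice of laurent by <:].
HB.instance Definition _ :=
  [SubChoice_isSubComNzRing of laurent by <:].

Definition laurent_unit : {pred laurent} :=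
  fun x => (val x != 0) && ((val x)^-1 \in is_laurent).

Definition laurent_inv (x : laurent) : laurent :=
  if x \in laurent_unit then insubd x (val x)^-1 else x.

Fact laurent_mulVr : {in laurent_unit, left_inverse 1 laurent_inv *%R}.
Proof.
move=> x xU; rewrite /laurent_inv xU; case/andP: xU => x0 xV.
by apply: val_inj; rewrite rmorphM /= insubdK // mulVf.
Qed.

Fact laurent_unitP x y : y * x = 1 -> laurent_unit x.
Proof.
move=> /(congr1 val); rewrite rmorphM rmorph1 /= => yx1.
have x0 : val x != 0.
  by apply/eqP => x0; move: yx1; rewrite x0 mulr0 => /esym/eqP; rewrite oner_eq0.
rewrite /laurent_unit x0 /=.
suff -> : (val x)^-1 = val y by exact: valP.
by apply: (mulIf x0); rewrite mulVf.
Qed.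

Fact laurent_inv_out : {in [predC laurent_unit], laurent_inv =1 id}.
Proof. by move=> x xU; rewrite /laurent_inv ifN. Qed.

HB.instance Definition _ := GRing.ComNzRing_hasMulInverse.Build laurent
  laurent_mulVr laurent_unitP laurent_inv_out.

End LaurentDef.

Notation "{ 'laurent' R }" := (laurent R) (format "{ 'laurent'  R }") : type_scope.

(* The general linear group of a possibly infinite ring; the library's
   [{'GL_n[R]}] requires R to be finite. *)
Section GeneralLinear.
Local Open Scope ring_scope.
Variables (n : nat) (R : comUnitRingType).

Record GL : predArgType := GLmx {
  GL_mx :> 'M[R]_n;
  _ : GL_mx \in unitmx
}.

HB.instance Definition _ := [isSub for GL_mx].
HB.instance Definition _ := [Choice of GL by <:].

Implicit Types A B : GL.

Fact GL_mul_unit A B : GL_mx A *m GL_mx B \in unitmx.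
Proof. by rewrite unitmx_mul !(valP A, valP B). Qed.

Fact GL_inv_unit A : invmx A \in unitmx.
Proof. by rewrite unitmx_inv (valP A). Qed.

Definition GL_one : GL := GLmx (unitmx1 R n).
Definition GL_mul A B : GL := GLmx (GL_mul_unit A B).
Definition GL_inv A : GL := GLmx (GL_inv_unit A).

Fact GL_mulA : associative GL_mul.
Proof. by move=> A B C; apply: val_inj; rewrite /= mulmxA. Qed.

Fact GL_mul1 : left_id GL_one GL_mul.
Proof. by move=> A; apply: val_inj; rewrite /= mul1mx. Qed.

Fact GL_mulr1 : right_id GL_one GL_mul.
Proof. by move=> A; apply: val_inj; rewrite /= mulmx1. Qed.

Fact GL_mulV : left_inverse GL_one GL_inv GL_mul.
Proof. by move=> A; apply: val_inj; rewrite /= mulVmx // (valP A). Qed.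

Fact GL_mulrV : right_inverse GL_one GL_inv GL_mul.
Proof. by move=> A; apply: val_inj; rewrite /= mulmxV // (valP A). Qed.

HB.instance Definition _ :=
  isGroup.Build GL GL_mulA GL_mul1 GL_mulr1 GL_mulV GL_mulrV.

End GeneralLinear.

(* The group presented by generators X and relations u = v for [rel u v].
   The letter (x, false) stands for the generator x, (x, true) for x^-1. *)
Section Presentation.
Local Open Scope quotient_scope.
Variable X : choiceType.

Definition word : Type := seq (X * bool).

HB.instance Definition _ := Choice.on word.

Definition letter (x : X) : X * bool := (x, false).
Definition word_inv (w : word) : word := rev [seq (l.1, ~~ l.2) | l <- w].

Variable rel : word -> word -> Prop.

Inductive pres_eqv : word -> word -> Prop :=
  | PresRefl u : pres_eqv u u
  | PresSym u v : pres_eqv u v -> pres_eqv v u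
  | PresTrans u v w : pres_eqv u v -> pres_eqv v w -> pres_eqv u w
  | PresCat u u' v v' :
      pres_eqv u u' -> pres_eqv v v' -> pres_eqv (u ++ v) (u' ++ v')
  | PresCancel x b : pres_eqv [:: (x, b); (x, ~~ b)] [::]
  | PresRel u v : rel u v -> pres_eqv u v.

Definition pres_eqb (u v : word) : bool := `[< pres_eqv u v >].

Fact pres_eqb_refl : reflexive pres_eqb.
Proof. by move=> u; apply/asboolP; apply: PresRefl. Qed.

Fact pres_eqb_sym : symmetric pres_eqb.
Proof. by move=> u v; apply/asboolP/asboolP; apply: PresSym. Qed.

Fact pres_eqb_trans : transitive pres_eqb.
Proof.
by move=> v u w /asboolP uv /asboolP vw; apply/asboolP; apply: PresTrans vw.
Qed.

Canonical pres_equiv :=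
  EquivRel pres_eqb pres_eqb_refl pres_eqb_sym pres_eqb_trans.

Definition presented : Type := {eq_quot pres_eqb}.

HB.instance Definition _ : EqQuotient _ pres_eqb presented :=
  EqQuotient.on presented.
HB.instance Definition _ := Choice.on presented.

Definition pres_class (w : word) : presented := \pi_presented w.

Lemma pres_classP u v : pres_class u = pres_class v <-> pres_eqv u v.
Proof.
by split=> [/eqmodP/asboolP //|uv]; apply/eqmodP/asboolP.
Qed.

Lemma repr_pres_class u : pres_eqv (repr (pres_class u)) u.
Proof. by apply/pres_classP; rewrite /pres_class reprK. Qed.

Lemma word_inv_cat u v : word_inv (u ++ v) = word_inv v ++ word_inv u.
Proof. by rewrite /word_inv map_cat rev_cat. Qed.

Lemma word_invK : involutive word_inv.
Proof.
move=> u; rewrite /word_inv map_rev revK -map_comp.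
by rewrite -[RHS]map_id; apply: eq_map => -[x b] /=; rewrite negbK.
Qed.

Lemma pres_eqv_mulVw u : pres_eqv (word_inv u ++ u) [::].
Proof.
elim: u => [|[x b] u IHu]; first exact: PresRefl.
rewrite -cat1s word_inv_cat -catA [word_inv [:: _]]/=.
apply: PresTrans IHu; apply: PresCat; first exact: PresRefl.
rewrite catA -[X in pres_eqv _ X]cat0s; apply: PresCat; last exact: PresRefl.
by have := PresCancel x (~~ b); rewrite negbK.
Qed.

Lemma pres_eqv_mulwV u : pres_eqv (u ++ word_inv u) [::].
Proof. by have := pres_eqv_mulVw (word_inv u); rewrite word_invK. Qed.

Lemma pres_eqv_inv u v : pres_eqv u v -> pres_eqv (word_inv u) (word_inv v).
Proof.
move=> uv; apply: (@PresTrans _ (word_inv u ++ (v ++ word_inv v))).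
  rewrite -[X in pres_eqv X _]cats0; apply: PresCat; first exact: PresRefl.
  exact/PresSym/pres_eqv_mulwV.
rewrite -[X in pres_eqv _ X]cat0s catA; apply: PresCat; last exact: PresRefl.
apply: PresTrans (pres_eqv_mulVw u); apply: PresCat; first exact: PresRefl.
exact: PresSym.
Qed.

Definition pres_one : presented := pres_class [::].
Definition pres_mul (a b : presented) : presented :=
  pres_class (repr a ++ repr b).
Definition pres_inv (a : presented) : presented :=
  pres_class (word_inv (repr a)).

Lemma pres_mulE u v :
  pres_mul (pres_class u) (pres_class v) = pres_class (u ++ v).
Proof. by apply/pres_classP; apply: PresCat; apply: repr_pres_class. Qed.

Lemma pres_invE u : pres_inv (pres_class u) = pres_class (word_inv u).
Proof. exact/pres_classP/pres_eqv_inv/repr_pres_class. Qed.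

Fact pres_mulA : associative pres_mul.
Proof.
elim/quotW=> u; elim/quotW=> v; elim/quotW=> w.
by rewrite -!/(pres_class _) !pres_mulE catA.
Qed.

Fact pres_mul1 : left_id pres_one pres_mul.
Proof. by elim/quotW=> u; rewrite -!/(pres_class _) pres_mulE. Qed.

Fact pres_mulr1 : right_id pres_one pres_mul.
Proof. by elim/quotW=> u; rewrite -!/(pres_class _) pres_mulE cats0. Qed.

Fact pres_mulV : left_inverse pres_one pres_inv pres_mul.
Proof.
elim/quotW=> u; rewrite -!/(pres_class _) pres_invE pres_mulE.
exact/pres_classP/pres_eqv_mulVw.
Qed.

Fact pres_mulrV : right_inverse pres_one pres_inv pres_mul.
Proof.
elim/quotW=> u; rewrite -!/(pres_class _) pres_invE pres_mulE.
exact/pres_classP/pres_eqv_mulwV.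
Qed.

HB.instance Definition _ :=
  isGroup.Build presented pres_mulA pres_mul1 pres_mulr1 pres_mulV pres_mulrV.

Definition pres_gen (x : X) : presented := pres_class [:: letter x].

End Presentation.

(* Generators are indexed from 0: the index i : 'I_n.-1 stands for s_(i+1). *)
Inductive twin_rel (n : nat) : word 'I_n.-1 -> word 'I_n.-1 -> Prop :=
  | TwinSquare (i : 'I_n.-1) : twin_rel [:: letter i; letter i] [::]
  | TwinComm (i j : 'I_n.-1) : (2 <= `|i - j|)%N ->
      twin_rel [:: letter i; letter j] [:: letter j; letter i].

Definition twin_group (n : nat) : groupType := presented (@twin_rel n).

Definition twin_gen (n : nat) (i : 'I_n.-1) : twin_group n :=
  pres_gen (@twin_rel n) i.

Section TwinMatrix.
Local Open Scope ring_scope.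
Variables (R : comUnitRingType) (n : nat).

Fact twin_block_size (i : 'I_n.-1) : (i + (2 + (n - i.+2)) = n)%N.
Proof.
by rewrite addnA addn2 subnKC //; case: n i => [[]|m i] //=; rewrite ltnS.
Qed.

Definition swap_mx (f : R) : 'M[R]_2 :=
  block_mx (0 : 'M_1) f%:M (f^-1)%:M (0 : 'M_1).

(* diag(I_i, swap_mx f, I_(n-i-2)); the 0-based i gives I_(i-1) and I_(n-i-1)
   in 1-based indexing. *)
Definition twin_mx (f : R) (i : 'I_n.-1) : 'M[R]_n :=
  castmx (twin_block_size i, twin_block_size i)
    (block_mx 1%:M 0
              0    (block_mx (swap_mx f) 0
                             0           1%:M)).

End TwinMatrix.

(* Main.v *)
Require Import Defs.
From HB Require Import structures.
From mathcomp Require Import all_boot all_order all_algebra.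
From mathcomp Require Import fingroup perm generic_quotient zify.

Local Open Scope ring_scope.
Import GRing.Theory.

(** The matrices of the representation are conjugate, by one and the same
    diagonal matrix, to matrices of transpositions: with 0-based indices, if
    D = diag(1, f, f^2, ...) and P is the matrix of the transposition (i i+1),
    then D^-1 P D has entry f^-i f^(i+1) = f at (i, i+1), entry
    f^-(i+1) f^i = f^-1 at (i+1, i), and agrees with P elsewhere
    ([power_perm_mx_twin]).  So no relation has to be checked on matrices: the
    map s |-> D^-1 P_s D is a homomorphism from the symmetric group to GL_n
    ([power_perm_GL]), and the transpositions (i i+1) satisfy the relations of
    the twin group, being involutions that commute as soon as they are disjoint
    ([twin_perm_lift], by the universal property [pres_lift_ex] of a group
    presentation).  The representation is the composite of these two
    homomorphisms. *)

Section PresentationLift.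
Local Open Scope group_scope.
Variables (X : choiceType) (rel : word X -> word X -> Prop).
Variables (G : groupType) (g : X -> G).

Definition letter_eval (l : X * bool) : G := if l.2 then (g l.1)^-1 else g l.1.

Definition word_eval (w : word X) : G := \big[*%g/1]_(l <- w) letter_eval l.

Hypothesis rel_eval : forall u v, rel u v -> word_eval u = word_eval v.

(** [pres_eqv] is the smallest congruence containing [rel] and the free
    cancellations, and the kernel of [word_eval] is another one. *)
Lemma word_eval_eqv u v : pres_eqv rel u v -> word_eval u = word_eval v.
Proof.
elim=> {u v} [//|u v _ ->//|u v w _ -> _ ->//|u u' v v' _ IHu _ IHv|x b|//].
  by rewrite /word_eval !big_cat /= -!/(word_eval _) IHu IHv.
rewrite /word_eval big_cons big_seq1 big_nil.
by case: b; rewrite /letter_eval /= (mulVg, mulgV).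
Qed.

Definition pres_lift (a : presented rel) : G := word_eval (repr a).

Lemma pres_lift_class u : pres_lift (pres_class rel u) = word_eval u.
Proof. exact/word_eval_eqv/repr_pres_class. Qed.

Lemma pres_lift_gen x : pres_lift (pres_gen rel x) = g x.
Proof. by rewrite pres_lift_class /word_eval big_seq1. Qed.

Fact pres_liftM : {morph pres_lift : a b / a * b}.
Proof. by move=> a b; rewrite pres_lift_class /word_eval big_cat. Qed.

HB.instance Definition _ := isMultiplicative.Build _ _ pres_lift pres_liftM.

(** The universal property of a group presentation. *)
Lemma pres_lift_ex :
  exists h : {multiplicative presented rel -> G},
    forall x, h (pres_gen rel x) = g x.
Proof. by exists pres_lift; apply: pres_lift_gen. Qed.

End PresentationLift.

Section TwinPerm.
Variable n : nat.
Implicit Types i j : 'I_n.-1.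

(** [twin_lo i] and [twin_hi i] are the two indices i and i.+1 of the nontrivial
    block of [twin_mx f i].  They go through [twin_block_size] because n need
    not be syntactically a successor. *)
Definition twin_lo i : 'I_n :=
  cast_ord (twin_block_size i) (rshift i (lshift _ ord0)).
Definition twin_hi i : 'I_n :=
  cast_ord (twin_block_size i) (rshift i (lshift _ ord_max)).

Lemma twin_loE i : twin_lo i = i :> nat. Proof. exact: addn0. Qed.
Lemma twin_hiE i : twin_hi i = i.+1 :> nat. Proof. exact: addn1. Qed.

Definition twin_perm i : 'S_n := tperm (twin_lo i) (twin_hi i).

(** Conjugating the first transposition by the second moves neither of its two
    points, as the two supports are disjoint. *)
Lemma twin_permC i j :
  (2 <= `|i - j|)%N -> (twin_perm i * twin_perm j = twin_perm j * twin_perm i)%g.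
Proof.
move=> far_ij; apply/commgP/conjg_fixP; rewrite tpermJ.
by congr tperm; apply: tpermD; rewrite -val_eqE /= ?addn0 ?addn1; lia.
Qed.

Lemma twin_perm_lift :
  exists h : {multiplicative twin_group n -> 'S_n},
    forall i, h (twin_gen i) = twin_perm i.
Proof.
apply: pres_lift_ex => _ _ [i|i j far_ij].
  by rewrite /word_eval big_cons big_seq1 big_nil; apply: tperm2.
by rewrite /word_eval !big_cons big_nil !mulg1; apply: twin_permC.
Qed.

End TwinPerm.

Lemma twin_splitP i m (c : 'I_(i + (2 + m))) :
  [\/ exists u, c = lshift _ u,
      c = rshift i (lshift m (lshift 1 (0 : 'I_1))),
      c = rshift i (lshift m (rshift 1 (0 : 'I_1)))
    | exists u, c = rshift i (rshift 2 u)].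
Proof.
case: (split_ordP c) => [u|v] ->; first by apply: Or41; exists u.
case: (split_ordP v) => [w|u] ->; last by apply: Or44; exists u.
by case: (@split_ordP 1 1 w) => z ->; rewrite [z]ord1; [apply: Or42|apply: Or43].
Qed.

Lemma swap_mxE (R : comUnitRingType) (f : R) (z : 'I_1) :
  (swap_mx f (lshift 1 z) (lshift 1 z) = 0)
  * (swap_mx f (lshift 1 z) (rshift 1 z) = f)
  * (swap_mx f (rshift 1 z) (lshift 1 z) = f^-1)
  * (swap_mx f (rshift 1 z) (rshift 1 z) = 0).
Proof.
(* The four lemmas are applied up to the conversion between 2 and 1 + 1. *)
do !split; [apply: etrans (@block_mxEul R 1 1 1 1 _ _ _ _ _ _) _
  | apply: etrans (@block_mxEur R 1 1 1 1 _ _ _ _ _ _) _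
  | apply: etrans (@block_mxEdl R 1 1 1 1 _ _ _ _ _ _) _
  | apply: etrans (@block_mxEdr R 1 1 1 1 _ _ _ _ _ _) _];
  by rewrite mxE ?eqxx ?[z]ord1.
Qed.

(** The block decomposition, read as a formula on the entries: this is the form
    in which [twin_mx] can be compared with a permutation matrix. *)
Lemma twin_mxE (R : comUnitRingType) n (f : R) (i : 'I_n.-1) (a b : 'I_n) :
  twin_mx f i a b = if a == twin_lo n i then f *+ (b == twin_hi n i)
                    else if a == twin_hi n i then f^-1 *+ (b == twin_lo n i)
                    else (a == b)%:R.
Proof.
rewrite castmxE -!(inj_eq (@ord_inj n)) twin_loE twin_hiE /=.
have -> : a = cast_ord (esym (twin_block_size i)) a :> nat by [].
have -> : b = cast_ord (esym (twin_block_size i)) b :> nat by [].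
move: (cast_ord _ a) (cast_ord _ b) => {}a {}b.
(* Both indices fall into one of four ranges; the ordinals are destructed so
   that their bounds refute the conditions that cannot hold. *)
case: (twin_splitP _ _ a) => [[[u lt_u]]|||[[u lt_u]]] ->;
  case: (twin_splitP _ _ b) => [[[v lt_v]]|||[[v lt_v]]] ->.
all: rewrite ?(block_mxEul, block_mxEur, block_mxEdl, block_mxEdr) ?swap_mxE ?mxE
  -?(inj_eq (@ord_inj _)) /=.
all: do ?[case: eqP => /=]; try lia.
all: rewrite ?mulr1n //.
Qed.

Section ConjugatedPermutations.
Variables (R : comUnitRingType) (n : nat) (f : R).
Hypothesis f_unit : f \is a GRing.unit.

(** The diagonal matrix carries the powers of f because the ratio of consecutive
    diagonal entries has to be f, whichever transposition (i i+1) is taken. *)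
Definition power_perm_mx (s : 'S_n) : 'M[R]_n :=
  diag_mx (\row_a f ^- a) *m perm_mx s *m diag_mx (\row_a f ^+ a).

Lemma power_perm_mxE s a b :
  power_perm_mx s a b = f ^- a * f ^+ b *+ (s a == b).
Proof.
rewrite /power_perm_mx mul_mx_diag mul_diag_mx !mxE.
by case: eqP; rewrite ?mulr1 ?mulr0 ?mul0r.
Qed.

Lemma power_perm_mxM s t :
  power_perm_mx (s * t)%g = power_perm_mx s *m power_perm_mx t.
Proof.
have diagK : diag_mx (\row_(a < n) f ^+ a) *m diag_mx (\row_a f ^- a) = 1%:M.
  rewrite mulmx_diag -diag_const_mx; congr diag_mx.
  by apply/rowP=> a; rewrite !mxE divrr ?unitrX.
rewrite /power_perm_mx perm_mxM !mulmxA; congr (_ *m _ *m _).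
by rewrite -[in RHS](mulmxA _ (diag_mx _)) diagK mulmx1.
Qed.

Lemma power_perm_mx_unit s : power_perm_mx s \in unitmx.
Proof.
have unit_diag (d : 'rV[R]_n) : (forall a, d 0 a \is a GRing.unit) ->
    diag_mx d \in unitmx.
  by move=> dU; rewrite unitmxE det_diag rpred_prod.
rewrite !unitmx_mul unitmx_perm !unit_diag // => a; rewrite mxE ?unitrV;
  exact: unitrX.
Qed.

Definition power_perm_GL (s : 'S_n) : GL n R := GLmx (power_perm_mx_unit s).

Fact power_perm_GL_M : {morph power_perm_GL : s t / (s * t)%g}.
Proof. by move=> s t; apply: val_inj; apply: power_perm_mxM. Qed.

HB.instance Definition _ :=
  isMultiplicative.Build _ _ power_perm_GL power_perm_GL_M.

(** Adjacent powers of f cancel to f and f^-1 on the swapped pair, equal powers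
    to 1 on the remaining diagonal. *)
Lemma power_perm_mx_twin i : power_perm_mx (twin_perm n i) = twin_mx f i.
Proof.
have fXV k : f ^- k * f ^+ k = 1 by rewrite mulVr ?unitrX.
apply/matrixP=> a b; rewrite power_perm_mxE twin_mxE /twin_perm.
case: tpermP => [->|->|/eqP/negPf-> /eqP/negPf->].
- rewrite eqxx [b == _]eq_sym; case: eqP => // <-.
  by rewrite !mulr1n twin_loE twin_hiE exprSr mulrA fXV mul1r.
- have /negPf-> : twin_hi n i != twin_lo n i.
    by rewrite -(inj_eq (@ord_inj n)) twin_loE twin_hiE gtn_eqF.
  rewrite eqxx [b == _]eq_sym; case: eqP => // <-.
  by rewrite !mulr1n twin_loE twin_hiE exprS invrM ?unitrX // mulrAC fXV mul1r.
- by case: eqP => // <-; rewrite fXV.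
Qed.

End ConjugatedPermutations.

Theorem proposition15 (n : nat) (n_ge2 : (2 <= n)%N)
    (f : {laurent int}) (f_unit : f \is a GRing.unit) :
  exists eta : {multiplicative twin_group n -> GL n {laurent int}},
    forall i : 'I_n.-1, GL_mx (eta (twin_gen i)) = twin_mx f i.
Proof.
have [h h_gen] := twin_perm_lift n.
exists (power_perm_GL _ n f f_unit \o h) => i /=.
by rewrite h_gen power_perm_mx_twin.
Qed.
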